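(* Let $\mathbf{k}$ be a commutative $\mathbb{Q}$-algebra and $N\geq 1$ an integer. For every $m\in\mathbb{Z}$, $$\Delta^{\mathcal{W},\mathrm{B}}\big(\mathcal{F}^m\mathcal{W}^{\mathrm{B}}_N\big)\subset \mathcal{F}^m\big(\mathcal{W}^{\mathrm{B}}_N\otimes\mathcal{W}^{\mathrm{B}}_N\big).$$
   Context: Products of submodules: for $\mathbf{k}$-submodules $A_1,\dots,A_k$ of a $\mathbf{k}$-algebra $A$ and positive integers $n_1,\dots,n_k$, $A_1^{n_1}\cdots A_k^{n_k}$ denotes the image of $A_1^{\otimes n_1}\otimes\cdots\otimes A_k^{\otimes n_k}\to A$ induced by the product (i.e. the $\mathbf{k}$-span of products). Tensor products are over $\mathbf{k}$. The algebra $\mathcal{V}^{\mathrm{B}}_N$: let $\mu_N$ be the group of complex $N$-th roots of unity, $\zeta_N=e^{2\pi \mathrm{i}/N}$. Let $F_2$ be the free group on $X_0,X_1$ and $F_2\to\mu_N$ the group morphism $X_0\mapsto\zeta_N$, $X_1\mapsto 1$. Let $\mathcal{I}_N:=\ker(\mathbf{k}F_2\to\mathbf{k}\mu_N)$ be the kernel of the induced group algebra morphism. $\mathcal{V}^{\mathrm{B}}_N$ is the group algebra $\mathbf{k}F_2$ with the decreasing algebra filtration $\mathcal{F}^m\mathcal{V}^{\mathrm{B}}_N=\mathbf{k}F_2$ for $m\le 0$ and $\mathcal{F}^m\mathcal{V}^{\mathrm{B}}_N=\mathcal{I}_N^m$ for $m>0$. The algebra $\mathcal{W}^{\mathrm{B}}_N$: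 it is the subalgebra $\mathcal{W}^{\mathrm{B}}_N:=\mathbf{k}\oplus\mathcal{V}^{\mathrm{B}}_N(X_1-1)$ of $\mathcal{V}^{\mathrm{B}}_N$, with algebra filtration $\mathcal{F}^m\mathcal{W}^{\mathrm{B}}_N:=\mathcal{W}^{\mathrm{B}}_N\cap\mathcal{F}^m\mathcal{V}^{\mathrm{B}}_N$, $m\in\mathbb{Z}$. As an algebra it does not depend on $N$; the underlying algebra is denoted $\mathcal{W}^{\mathrm{B}}$. Filtration of the tensor square: $\mathcal{F}^m(\mathcal{W}^{\mathrm{B}}_N\otimes\mathcal{W}^{\mathrm{B}}_N):=\sum_{i+j=m}\mathcal{F}^i\mathcal{W}^{\mathrm{B}}_N\otimes\mathcal{F}^j\mathcal{W}^{\mathrm{B}}_N$ (sum of the images in $\mathcal{W}^{\mathrm{B}}_N\otimes\mathcal{W}^{\mathrm{B}}_N$, over $i,j\in\mathbb{Z}$). The coproduct: it is known that the algebra $\mathcal{W}^{\mathrm{B}}$ is generated by $X_1^{-1}$ and $X_0^n(X_1-1)$, $n\in\mathbb{Z}$, and that there is a (necessarily unique) algebra morphism $\Delta^{\mathcal{W},\mathrm{B}}:\mathcal{W}^{\mathrm{B}}\to\mathcal{W}^{\mathrm{B}}\otimes\mathcal{W}^{\mathrm{B}}$, making $\mathcal{W}^{\mathrm{B}}$ a bialgebra, such that $$\Delta^{\mathcal{W},\mathrm{B}}(X_1^{-1})=X_1^{-1}Y_1^{-1},$$ $$\Delta^{\mathcal{W},\mathrm{B}}(X_0^n(X_1-1))=X_0^n(X_1-1)+Y_0^n(Y_1-1)-\sum_{k=1}^{n-1}X_0^k(X_1-1)\,Y_0^{n-k}(Y_1-1)\quad(n\in\mathbb{Z}),$$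 where on the right-hand sides $X_i^{\pm1}$ stands for $X_i^{\pm1}\otimes 1$ and $Y_i^{\pm1}:=1\otimes X_i^{\pm1}$ ($i\in\{0,1\}$). Summation convention, for $p,q\in\mathbb{Z}$: $\sum_{k=p}^q f(k)$ is $f(p)+\cdots+f(q)$ if $q>p-1$, is $0$ if $q=p-1$, and is $-f(p-1)-\cdots-f(q+1)$ if $q<p-1$. *)

(* Defs.v *)
From HB Require Import structures.
From Stdlib Require Rdefinitions Rtrigo_def Rtrigo1.
From mathcomp Require Import all_boot all_order all_algebra.
From mathcomp Require Import finmap generic_quotient boolp classical_sets.
From mathcomp Require Import monalg complex Rstruct.

Set Implicit Arguments.
Unset Strict Implicit.
Unset Printing Implicit Defensive.

Import GRing.Theory.

Local Open Scope ring_scope.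
Local Open Scope quotient_scope.

Definition span (k : comPzRingType) (M : lmodType k) (S : set M) : set M :=
  [set x | exists (n : nat) (c : 'I_n -> k) (v : 'I_n -> M),
    (forall i, S (v i)) /\ x = \sum_i c i *: v i].

(* Free group on S: reduced words in the letters (s, true) = s and
   (s, false) = s^-1. *)
Section FreeGroup.
Variable S : choiceType.
Implicit Types (l : S * bool) (u v w : seq (S * bool)).

Definition linv l : S * bool := (l.1, ~~ l.2).

Definition reduced w := sorted (fun l l' => l' != linv l) w.

Definition push l w :=
  if w is l' :: w' then if l' == linv l then w' else l :: w else [:: l].

Record freegroup := FreeGroup { fgword :> seq (S * bool); _ : reduced fgword }.

HB.instance Definition _ := [isSub for fgword].
HB.instance Definition _ := [Choice of freegroup by <:].

Lemma fgwordP (x : freegroup) : reduced x. Proof. exact: valP. Qed.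

Lemma linvK : involutive linv.
Proof. by case=> s b; rewrite /linv /= negbK. Qed.

Lemma reduced_push l w : reduced w -> reduced (push l w).
Proof.
case: w => [|l' w] //= red_w; case: eqVneq => [_|neq_l'] /=.
  by case: w red_w => //= l'' w /andP[].
by rewrite neq_l'.
Qed.

Lemma pushK l w : reduced w -> push l (push (linv l) w) = w.
Proof.
case: w => [|l' w] /=; first by rewrite eqxx.
rewrite linvK; case: eqVneq => [->|neq_l' _] /=; last by rewrite eqxx.
by case: w => [|l'' w] //= /andP[/negbTE ->].
Qed.

Lemma reduced_foldr u w : reduced w -> reduced (foldr push w u).
Proof. by move=> red_w; elim: u => //= l u; apply: reduced_push. Qed.

Lemma foldr_push_id w : reduced w -> foldr push [::] w = w.
Proof.
elim: w => //= l w IHw red_w.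
rewrite IHw; last by case: w red_w {IHw} => //= l' w /andP[].
by case: w red_w {IHw} => //= l' w /andP[/negbTE ->].
Qed.

Lemma foldr_push u w :
  reduced w -> foldr push w (foldr push [::] u) = foldr push w u.
Proof.
move=> red_w; elim: u => //= l u IHu; rewrite -IHu.
case: (foldr push [::] u) => //= l' u'; case: eqVneq => //= ->.
by rewrite pushK // reduced_foldr.
Qed.

Definition fg_mul (x y : freegroup) : freegroup :=
  FreeGroup (reduced_foldr x (fgwordP y)).

Definition fg_one : freegroup := FreeGroup (erefl : reduced [::]).

Lemma reduced_inv w : reduced w -> reduced (rev (map linv w)).
Proof.
rewrite /reduced rev_sorted sorted_map; apply: sub_sorted => l l'.
by rewrite /= linvK eq_sym -(inj_eq (inv_inj linvK)) linvK.
Qed.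

Definition fg_inv (x : freegroup) : freegroup :=
  FreeGroup (reduced_inv (fgwordP x)).

Lemma fg_mulA : associative fg_mul.
Proof.
move=> x y z; apply: val_inj => /=.
have -> : foldr push y x = foldr push [::] (x ++ y).
  by rewrite foldr_cat foldr_push_id ?fgwordP.
by rewrite foldr_push ?fgwordP // foldr_cat.
Qed.

Lemma fg_mul1 : left_id fg_one fg_mul.
Proof. by move=> x; apply: val_inj. Qed.

Lemma fg_mulr1 : right_id fg_one fg_mul.
Proof. by move=> x; apply: val_inj; rewrite /= foldr_push_id ?fgwordP. Qed.

Lemma foldr_pushV w : foldr push [::] (rev (map linv w) ++ w) = [::].
Proof.
elim: w => //= l w IHw; rewrite rev_cons cat_rcons foldr_cat /=.
have := @pushK (linv l) (foldr push [::] w); rewrite linvK => ->.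
  by rewrite -foldr_cat.
exact: reduced_foldr.
Qed.

Lemma fg_mulV : left_inverse fg_one fg_inv fg_mul.
Proof.
move=> x; apply: val_inj => /=.
by rewrite -[X in foldr _ X](foldr_push_id (fgwordP x)) -foldr_cat foldr_pushV.
Qed.

Lemma fg_invK : involutive fg_inv.
Proof.
move=> x; apply: val_inj => /=.
by rewrite map_rev revK -map_comp map_id_in // => l _ /=; rewrite linvK.
Qed.

Lemma fg_mulrV : right_inverse fg_one fg_inv fg_mul.
Proof. by move=> x; rewrite -{1}[x]fg_invK fg_mulV. Qed.

HB.instance Definition _ :=
  isGroup.Build freegroup fg_mulA fg_mul1 fg_mulr1 fg_mulV fg_mulrV.

Definition fg_gen (s : S) : freegroup :=
  FreeGroup (erefl : reduced [:: (s, true)]).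

Variables (H : groupType) (f : S -> H).

Definition fg_lift (x : freegroup) : H :=
  (\prod_(l <- fgword x) if l.2 then f l.1 else (f l.1)^-1)%g.

Lemma fg_lift_gen s : fg_lift (fg_gen s) = f s.
Proof. by rewrite /fg_lift big_seq1. Qed.

Lemma fg_lift_is_morphism :
  (fg_lift 1%g = 1%g) * {morph fg_lift : x y / (x * y)%g}.
Proof.
split=> [|x y]; first by rewrite /fg_lift big_nil.
rewrite /fg_lift /=; elim: (fgword x) => [|l u IHu] /=.
  by rewrite big_nil mul1g.
rewrite big_cons -mulgA -{}IHu.
case: (foldr push y u) => [|l' w] /=; first by rewrite big_seq1 big_nil mulg1.
case: eqVneq => [->|_]; last by rewrite !big_cons.
by rewrite big_cons /=; case: l.2; rewrite /= ?mulKVg ?mulKg ?mulVKg.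
Qed.

HB.instance Definition _ :=
  isUMagmaMorphism.Build freegroup H fg_lift fg_lift_is_morphism.

End FreeGroup.

Definition gexpz (G : groupType) (x : G) (n : int) : G :=
  match n with Posz p => (x ^+ p)%g | Negz p => (x ^- p.+1)%g end.

(* k[G]: finitely supported functions G -> k; << c *g x >> is c times the basis
   element x.  The ring structure that monalg puts on this type is only for
   monoids without nontrivial units, hence the alias. *)
Definition grpalg (k : comPzRingType) (G : groupType) : Type := {malg k[G]}.

HB.instance Definition _ (k : comPzRingType) (G : groupType) :=
  GRing.Zmodule.on (grpalg k G).

HB.lock Definition ga_base (k : comPzRingType) (G : groupType) (x : G) :
    grpalg k G :=
  << x >>.

HB.lock Definition ga_scale (k : comPzRingType) (G : groupType) (c : k)
    (f : grpalg k G) : grpalg k G :=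
  \sum_(x <- msupp f) << c * f@_x *g x >>.

HB.lock Definition ga_mul (k : comPzRingType) (G : groupType)
    (f g : grpalg k G) : grpalg k G :=
  \sum_(x <- msupp f) \sum_(y <- msupp g) << f@_x * g@_y *g (x * y)%g >>.

Section GroupAlgebra.
Variables (k : comPzRingType) (G : groupType).

Local Notation grpalg := (grpalg k G).
Local Notation ga_base := (@ga_base k G).
Local Notation ga_scale := (@ga_scale k G).
Local Notation ga_mul := (@ga_mul k G).

Implicit Types (c : k) (x y : G) (f g h : grpalg).

Lemma ga_scaleE c f x : (ga_scale c f)@_x = c * f@_x.
Proof.
rewrite ga_scale.unlock [in RHS](monalgE f) !raddf_sum mulr_sumr.
by apply/eq_bigr => /= y _; rewrite !mcoeffU mulrnAr.
Qed.

Lemma ga_scaleA c d f : ga_scale c (ga_scale d f) = ga_scale (c * d) f.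
Proof. by apply/malgP => x; rewrite !ga_scaleE mulrA. Qed.

Lemma ga_scale1 : left_id 1 ga_scale.
Proof. by move=> f; apply/malgP => x; rewrite ga_scaleE mul1r. Qed.

Lemma ga_scaleDr : right_distributive ga_scale +%R.
Proof.
by move=> c f g; apply/malgP => x; rewrite !(mcoeffD, ga_scaleE) mulrDr.
Qed.

Lemma ga_scaleDl f : {morph ga_scale^~ f : c d / c + d}.
Proof.
by move=> c d; apply/malgP => x; rewrite !(mcoeffD, ga_scaleE) mulrDl.
Qed.

HB.instance Definition _ := GRing.Zmodule_isLmodule.Build k grpalg
  ga_scaleA ga_scale1 ga_scaleDr ga_scaleDl.

Lemma ga_mulw (d1 d2 : {fset G}) f g :
  (msupp f `<=` d1)%fset -> (msupp g `<=` d2)%fset ->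
  ga_mul f g = \sum_(x <- d1) \sum_(y <- d2) << f@_x * g@_y *g (x * y)%g >>.
Proof.
move=> le1 le2; rewrite ga_mul.unlock (big_fset_incl _ le1) /=.
  apply/eq_bigr => x _; apply/big_fset_incl => // y _ /mcoeff_outdom ->.
  by rewrite mulr0 monalgU0.
move=> x _ /mcoeff_outdom fx.
by rewrite big1 // => y _; rewrite fx mul0r monalgU0.
Qed.

Lemma ga_mul0r : left_zero 0 ga_mul.
Proof. by move=> f; rewrite ga_mul.unlock msupp0 big_seq_fset0. Qed.

Lemma ga_mulr0 : right_zero 0 ga_mul.
Proof.
by move=> f; rewrite ga_mul.unlock msupp0 big1 // => x _; rewrite big_seq_fset0.
Qed.

Lemma ga_mulUU c d x y :
  ga_mul << c *g x >> << d *g y >> = << c * d *g (x * y)%g >>.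
Proof. by rewrite (ga_mulw msuppU_le msuppU_le) !big_seq_fset1 !mcoeffUU. Qed.

Lemma ga_mulDl : left_distributive ga_mul +%R.
Proof.
move=> f g h.
pose D := (msupp f `|` msupp g)%fset; have hh := fsubset_refl (msupp h).
rewrite (ga_mulw (msuppD_le f g) hh) (ga_mulw (fsubsetUl _ (msupp g)) hh).
rewrite (ga_mulw (fsubsetUr (msupp f) _) hh).
rewrite -big_split /=; apply/eq_bigr => x _.
rewrite -big_split /=; apply/eq_bigr => y _.
by rewrite mcoeffD mulrDl monalgUD.
Qed.

Lemma ga_mulDr : right_distributive ga_mul +%R.
Proof.
move=> h f g; have hh := fsubset_refl (msupp h).
rewrite (ga_mulw hh (msuppD_le f g)) (ga_mulw hh (fsubsetUl _ (msupp g))).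
rewrite (ga_mulw hh (fsubsetUr (msupp f) _)).
rewrite -big_split /=; apply/eq_bigr => x _.
rewrite -big_split /=; apply/eq_bigr => y _.
by rewrite mcoeffD mulrDr monalgUD.
Qed.

Lemma grpalg_ind (P : grpalg -> Prop) :
  P 0 -> (forall f g, P f -> P g -> P (f + g)) ->
  (forall c x, P << c *g x >>) -> forall f, P f.
Proof.
move=> P0 PD PU f; rewrite [f]monalgE.
by elim/big_ind: _ => // x _; apply: PU.
Qed.

Lemma ga_mulA : associative ga_mul.
Proof.
move=> f g h; elim/grpalg_ind: f => [|f f' IHf IHf'|c x].
- by rewrite !ga_mul0r.
- by rewrite !ga_mulDl IHf IHf'.
elim/grpalg_ind: g => [|g g' IHg IHg'|d y].
- by rewrite !(ga_mul0r, ga_mulr0).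
- by rewrite !(ga_mulDl, ga_mulDr) IHg IHg'.
elim/grpalg_ind: h => [|h h' IHh IHh'|e z].
- by rewrite !ga_mulr0.
- by rewrite !ga_mulDr IHh IHh'.
by rewrite !ga_mulUU mulrA mulgA.
Qed.

Lemma ga_mul1r : left_id (ga_base 1%g) ga_mul.
Proof.
elim/grpalg_ind=> [|f g IHf IHg|c x]; first by rewrite ga_mulr0.
  by rewrite ga_mulDr IHf IHg.
by rewrite ga_base.unlock ga_mulUU mul1r mul1g.
Qed.

Lemma ga_mulr1 : right_id (ga_base 1%g) ga_mul.
Proof.
elim/grpalg_ind=> [|f g IHf IHg|c x]; first by rewrite ga_mul0r.
  by rewrite ga_mulDl IHf IHg.
by rewrite ga_base.unlock ga_mulUU mulr1 mulg1.
Qed.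

HB.instance Definition _ := GRing.Zmodule_isPzRing.Build grpalg
  ga_mulA ga_mul1r ga_mulr1 ga_mulDl ga_mulDr.

Lemma ga_scaleU c d x : c *: (<< d *g x >> : grpalg) = << c * d *g x >>.
Proof.
by apply/malgP => y; rewrite [LHS]ga_scaleE !mcoeffU mulrnAr.
Qed.

Lemma ga_scaleAl c f g : c *: (f * g) = (c *: f) * g.
Proof.
elim/grpalg_ind: f => [|f f' IHf IHf'|d x].
- by rewrite mul0r !scaler0 mul0r.
- by rewrite mulrDl !scalerDr mulrDl IHf IHf'.
elim/grpalg_ind: g => [|g g' IHg IHg'|e y].
- by rewrite !mulr0 scaler0.
- by rewrite !mulrDr scalerDr IHg IHg'.
by rewrite ga_scaleU /GRing.mul /= !ga_mulUU ga_scaleU mulrA.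
Qed.

Lemma ga_scaleAr c f g : c *: (f * g) = f * (c *: g).
Proof.
elim/grpalg_ind: f => [|f f' IHf IHf'|d x].
- by rewrite !mul0r scaler0.
- by rewrite !mulrDl scalerDr IHf IHf'.
elim/grpalg_ind: g => [|g g' IHg IHg'|e y].
- by rewrite scaler0 !mulr0 scaler0.
- by rewrite scalerDr !mulrDr scalerDr IHg IHg'.
by rewrite ga_scaleU /GRing.mul /= !ga_mulUU ga_scaleU mulrCA.
Qed.

Lemma ga_scale1l c f : (c *: (1 : grpalg)) * f = c *: f.
Proof. by rewrite -ga_scaleAl mul1r. Qed.

Lemma ga_scale1r c f : f * (c *: (1 : grpalg)) = c *: f.
Proof. by rewrite -ga_scaleAr mulr1. Qed.

Lemma ga_baseM x y : ga_base (x * y)%g = ga_base x * ga_base y.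
Proof. by rewrite ga_base.unlock /GRing.mul /= ga_mulUU mulr1. Qed.

Definition ideal_exp (I : set grpalg) (n : nat) : set grpalg :=
  span [set f | exists v : 'I_n -> grpalg, (forall i, I (v i)) /\ f = \prod_i v i].

End GroupAlgebra.

Definition grpalg_map (k : comPzRingType) (G H : groupType) (phi : G -> H)
    (f : grpalg k G) : grpalg k H :=
  \sum_(x <- msupp f) << f@_x *g phi x >>.

(* Tensor product of k-modules: formal sums of pairs, modulo the congruence
   generated by commutativity and the bilinearity relations. *)
Section Tensor.
Variables (k : comPzRingType) (A B : lmodType k).
Implicit Types (s t u : seq (A * B)).

Inductive tens_eq : seq (A * B) -> seq (A * B) -> Prop :=
| TensRefl s : tens_eq s s
| TensSym s t : tens_eq s t -> tens_eq t s
| TensTrans s t u : tens_eq s t -> tens_eq t u -> tens_eq s u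
| TensCat s s' t t' : tens_eq s s' -> tens_eq t t' -> tens_eq (s ++ t) (s' ++ t')
| TensCatC s t : tens_eq (s ++ t) (t ++ s)
| TensDl a a' b : tens_eq [:: (a + a', b)] [:: (a, b); (a', b)]
| TensDr a b b' : tens_eq [:: (a, b + b')] [:: (a, b); (a, b')]
| Tens0 b : tens_eq [:: (0, b)] [::]
| TensZ (c : k) a b : tens_eq [:: (c *: a, b)] [:: (a, c *: b)].

Definition tens_eqb s t := `[< tens_eq s t >].

Lemma tens_eqb_refl : reflexive tens_eqb.
Proof. by move=> s; apply/asboolP/TensRefl. Qed.

Lemma tens_eqb_sym : symmetric tens_eqb.
Proof. by move=> s t; apply/asboolP/asboolP => /TensSym. Qed.

Lemma tens_eqb_trans : transitive tens_eqb.
Proof.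
by move=> t s u /asboolP st /asboolP tu; apply/asboolP/(TensTrans st tu).
Qed.

Canonical tens_equiv :=
  EquivRel tens_eqb tens_eqb_refl tens_eqb_sym tens_eqb_trans.

Definition tensor := {eq_quot tens_equiv}.

HB.instance Definition _ : EqQuotient _ tens_equiv tensor :=
  EqQuotient.on tensor.
HB.instance Definition _ := Choice.on tensor.

Implicit Types (x y z : tensor) (a : A) (b : B).

Lemma tens_pi s t : tens_eq s t -> \pi_tensor s = \pi_tensor t.
Proof. by move=> st; apply/eqmodP/asboolP. Qed.

Lemma tens_repr s : tens_eq (repr (\pi_tensor s)) s.
Proof. by apply/asboolP/(@eqmodP _ tens_equiv); rewrite reprK. Qed.

Definition tens a b : tensor := \pi_tensor [:: (a, b)].

Definition tens_zero : tensor := \pi_tensor [::].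

Definition tens_add x y : tensor := \pi_tensor (repr x ++ repr y).

Lemma tens_addE s t :
  tens_add (\pi_tensor s) (\pi_tensor t) = \pi_tensor (s ++ t).
Proof. by apply/tens_pi/TensCat; apply: tens_repr. Qed.

Lemma tens_addA : associative tens_add.
Proof.
move=> x y z; rewrite -[x]reprK -[y]reprK -[z]reprK.
rewrite (tens_addE (repr x) (repr y)) (tens_addE (repr y) (repr z)).
by rewrite (tens_addE (repr x)) (tens_addE _ (repr z)) catA.
Qed.

Lemma tens_addC : commutative tens_add.
Proof.
move=> x y; rewrite -[x]reprK -[y]reprK !tens_addE.
exact/tens_pi/TensCatC.
Qed.

Lemma tens_add0 : left_id tens_zero tens_add.
Proof. by move=> x; rewrite -[x]reprK tens_addE. Qed.

HB.instance Definition _ :=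
  GRing.isNmodule.Build tensor tens_addA tens_addC tens_add0.

Lemma tens_pi_sum s : \pi_tensor s = \sum_(p <- s) tens p.1 p.2.
Proof.
elim: s => [|[a b] s IHs]; first by rewrite big_nil.
by rewrite big_cons -IHs /GRing.add /= tens_addE.
Qed.

Lemma tens_sum x : x = \sum_(p <- repr x) tens p.1 p.2.
Proof. by rewrite -tens_pi_sum reprK. Qed.

Lemma tensDl a a' b : tens (a + a') b = tens a b + tens a' b.
Proof. by rewrite /GRing.add /= tens_addE; apply/tens_pi/TensDl. Qed.

Lemma tensDr a b b' : tens a (b + b') = tens a b + tens a b'.
Proof. by rewrite /GRing.add /= tens_addE; apply/tens_pi/TensDr. Qed.

Lemma tens0l b : tens 0 b = 0.
Proof. exact/tens_pi/Tens0. Qed.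

Lemma tensZlr c a b : tens (c *: a) b = tens a (c *: b).
Proof. exact/tens_pi/TensZ. Qed.

Section Lift.
Variables (M : nmodType) (F : A -> B -> M).
Hypotheses (FDl : forall a a' b, F (a + a') b = F a b + F a' b)
           (FDr : forall a b b', F a (b + b') = F a b + F a b')
           (F0 : forall b, F 0 b = 0)
           (FZ : forall c a b, F (c *: a) b = F a (c *: b)).

Lemma tens_eq_sum s t : tens_eq s t ->
  \sum_(p <- s) F p.1 p.2 = \sum_(p <- t) F p.1 p.2.
Proof.
elim=> {s t} //.
- by move=> s t u _ -> _ ->.
- by move=> s s' t t' _ ss' _ tt'; rewrite !big_cat /= ss' tt'.
- by move=> s t; rewrite !big_cat /= addrC.
- by move=> a a' b; rewrite !big_cons !big_nil /= !addr0 FDl.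
- by move=> a b b'; rewrite !big_cons !big_nil /= !addr0 FDr.
- by move=> b; rewrite big_seq1 big_nil F0.
- by move=> c a b; rewrite !big_seq1 FZ.
Qed.

Definition tens_lift x : M := \sum_(p <- repr x) F p.1 p.2.

Lemma tens_lift_pi s : tens_lift (\pi_tensor s) = \sum_(p <- s) F p.1 p.2.
Proof. exact/tens_eq_sum/tens_repr. Qed.

Lemma tens_liftE a b : tens_lift (tens a b) = F a b.
Proof. by rewrite tens_lift_pi big_seq1. Qed.

Lemma tens_lift0 : tens_lift 0 = 0.
Proof. by rewrite [LHS](tens_lift_pi [::]) big_nil. Qed.

Lemma tens_liftD : {morph tens_lift : x y / x + y}.
Proof.
move=> x y; rewrite -[x]reprK -[y]reprK.
by rewrite {1}/GRing.add /= tens_addE !tens_lift_pi big_cat.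
Qed.

End Lift.

Definition tens_scale (c : k) : tensor -> tensor :=
  tens_lift (fun a b => tens (c *: a) b).

Lemma tens_scaleE c a b : tens_scale c (tens a b) = tens (c *: a) b.
Proof.
rewrite /tens_scale tens_liftE // => *.
- by rewrite scalerDr tensDl.
- by rewrite tensDr.
- by rewrite scaler0 tens0l.
- by rewrite scalerA mulrC -scalerA tensZlr.
Qed.

Lemma tens_scaleDr : right_distributive tens_scale +%R.
Proof.
move=> c; apply: tens_liftD => *.
- by rewrite scalerDr tensDl.
- by rewrite tensDr.
- by rewrite scaler0 tens0l.
- by rewrite scalerA mulrC -scalerA tensZlr.
Qed.

Lemma tens_scale0 c : tens_scale c 0 = 0.
Proof. by rewrite -(tens0l 0) tens_scaleE scaler0. Qed.

Lemma tensor_ind (P : tensor -> Prop) :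
  P 0 -> (forall x y, P x -> P y -> P (x + y)) -> (forall a b, P (tens a b)) ->
  forall x, P x.
Proof.
move=> P0 PD Pt x; rewrite [x]tens_sum.
by elim/big_ind: _ => // p _; apply: Pt.
Qed.

Lemma tens_scaleA c d x : tens_scale c (tens_scale d x) = tens_scale (c * d) x.
Proof.
elim/tensor_ind: x => [|x y IHx IHy|a b]; first by rewrite !tens_scale0.
  by rewrite !tens_scaleDr IHx IHy.
by rewrite !tens_scaleE scalerA.
Qed.

Lemma tens_scale0r x : tens_scale 0 x = 0.
Proof.
elim/tensor_ind: x => [|x y IHx IHy|a b]; first by rewrite tens_scale0.
  by rewrite tens_scaleDr IHx IHy addr0.
by rewrite tens_scaleE scale0r tens0l.
Qed.

Lemma tens_scale1 : left_id 1 tens_scale.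
Proof.
elim/tensor_ind=> [|x y IHx IHy|a b]; first by rewrite tens_scale0.
  by rewrite tens_scaleDr IHx IHy.
by rewrite tens_scaleE scale1r.
Qed.

Lemma tens_scaleDl x : {morph tens_scale^~ x : c d / c + d}.
Proof.
move=> c d /=.
elim/tensor_ind: x => [|x y IHx IHy|a b]; first by rewrite !tens_scale0 addr0.
  by rewrite !tens_scaleDr IHx IHy addrACA.
by rewrite !tens_scaleE scalerDl tensDl.
Qed.

HB.instance Definition _ := GRing.Nmodule_isLSemiModule.Build k tensor
  tens_scaleA tens_scale0r tens_scale1 tens_scaleDr tens_scaleDl.
HB.instance Definition _ := GRing.LSemiModule_isLmodule.Build k tensor.

Lemma tensZl c a b : tens (c *: a) b = c *: tens a b.
Proof. by rewrite -tens_scaleE. Qed.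

Lemma tensZr c a b : tens a (c *: b) = c *: tens a b.
Proof. by rewrite -tensZlr tensZl. Qed.

Definition tens_submod (P : set A) (Q : set B) : set tensor :=
  span [set x | exists a b, [/\ P a, Q b & x = tens a b]].

(* The sum of a family of submodules is the span of their union. *)
Definition tens_filtration (F : int -> set A) (G : int -> set B) (m : int) :
    set tensor :=
  span [set x | exists i j : int, i + j = m /\ tens_submod (F i) (G j) x].

End Tensor.

(* MathComp's bundled algebra structures require 1 != 0.  To allow the zero ring
   as a base, an algebra below is a type with both an [lmodType k] and a
   [pzRingType] structure that are compatible in this sense. *)
Record is_algebra_law (k : comPzRingType) (A : lmodType k) (one : A)
    (mul : A -> A -> A) : Prop := IsAlgebraLaw {
  algA : associative mul;
  alg1l : left_id one mul;
  alg1r : right_id one mul;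
  algDl : left_distributive mul +%R;
  algDr : right_distributive mul +%R;
  algZl : forall (c : k) a b, mul (c *: a) b = c *: mul a b;
  algZr : forall (c : k) a b, mul a (c *: b) = c *: mul a b
}.

Section TensorAlgebra.
Variables (k : comPzRingType) (A B : lmodType k).
Variables (oneA : A) (mulA : A -> A -> A) (oneB : B) (mulB : B -> B -> B).
Hypotheses (lawA : is_algebra_law oneA mulA) (lawB : is_algebra_law oneB mulB).
Implicit Types (a : A) (b : B) (x y z : tensor A B).

Definition tens_mul x y : tensor A B :=
  tens_lift (fun a b => tens_lift (fun a' b' => tens (mulA a a') (mulB b b')) y)
    x.

Let mul0 a : mulA 0 a = 0.
Proof. by rewrite -{1}(scale0r (0 : A)) (algZl lawA) scale0r. Qed.
Let mulr0 a : mulA a 0 = 0.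
Proof. by rewrite -{1}(scale0r (0 : A)) (algZr lawA) scale0r. Qed.

Lemma tens_mul_inner a b :
  let F a' b' := tens (mulA a a') (mulB b b') in
  [/\ forall a1 a2 b', F (a1 + a2) b' = F a1 b' + F a2 b',
      forall a' b1 b2, F a' (b1 + b2) = F a' b1 + F a' b2,
      forall b', F 0 b' = 0 &
      forall (c : k) a' b', F (c *: a') b' = F a' (c *: b')].
Proof.
split=> *.
- by rewrite (algDr lawA) tensDl.
- by rewrite (algDr lawB) tensDr.
- by rewrite mulr0 tens0l.
- by rewrite (algZr lawA) (algZr lawB) tensZlr.
Qed.

Lemma tens_mul_outer y :
  let F a b := tens_lift (fun a' b' => tens (mulA a a') (mulB b b')) y in
  [/\ forall a1 a2 b, F (a1 + a2) b = F a1 b + F a2 b,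
      forall a b1 b2, F a (b1 + b2) = F a b1 + F a b2,
      forall b, F 0 b = 0 &
      forall (c : k) a b, F (c *: a) b = F a (c *: b)].
Proof.
rewrite /tens_lift; split=> *; rewrite -?big_split /=.
- by apply: eq_bigr => p _; rewrite (algDl lawA) tensDl.
- by apply: eq_bigr => p _; rewrite (algDl lawB) tensDr.
- by apply: big1 => p _; rewrite mul0 tens0l.
- by apply: eq_bigr => p _; rewrite (algZl lawA) (algZl lawB) tensZlr.
Qed.

Lemma tens_mulE a b a' b' :
  tens_mul (tens a b) (tens a' b') = tens (mulA a a') (mulB b b').
Proof.
have [? ? ? ?] := tens_mul_outer (tens a' b').
have [? ? ? ?] := tens_mul_inner a b.
by rewrite /tens_mul !tens_liftE.
Qed.

Lemma tens_mulDl : left_distributive tens_mul +%R.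
Proof.
by move=> x y z; have [? ? ? ?] := tens_mul_outer z; apply: tens_liftD.
Qed.

Lemma tens_mulDr : right_distributive tens_mul +%R.
Proof.
move=> x y z; rewrite /tens_mul {1 3 5}/tens_lift -big_split /=.
apply: eq_bigr => -[a b] _ /=.
by have [? ? ? ?] := tens_mul_inner a b; rewrite tens_liftD.
Qed.

Lemma tens_mul0l : left_zero 0 tens_mul.
Proof.
by move=> y; have [? ? ? ?] := tens_mul_outer y; apply: tens_lift0.
Qed.

Lemma tens_mul0r : right_zero 0 tens_mul.
Proof.
move=> x; rewrite /tens_mul {1}/tens_lift; apply: big1 => -[a b] _ /=.
by have [? ? ? ?] := tens_mul_inner a b; rewrite tens_lift0.
Qed.

Lemma tens_mulA : associative tens_mul.
Proof.
move=> x y z; elim/tensor_ind: x => [|x x' IHx IHx'|a b].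
- by rewrite !tens_mul0l.
- by rewrite !tens_mulDl IHx IHx'.
elim/tensor_ind: y => [|y y' IHy IHy'|a' b'].
- by rewrite !(tens_mul0l, tens_mul0r).
- by rewrite !(tens_mulDl, tens_mulDr) IHy IHy'.
elim/tensor_ind: z => [|z z' IHz IHz'|a'' b''].
- by rewrite !tens_mul0r.
- by rewrite !tens_mulDr IHz IHz'.
by rewrite !tens_mulE (algA lawA) (algA lawB).
Qed.

Lemma tens_mul1 : left_id (tens oneA oneB) tens_mul.
Proof.
elim/tensor_ind=> [|x y IHx IHy|a b]; first by rewrite tens_mul0r.
  by rewrite tens_mulDr IHx IHy.
by rewrite tens_mulE (alg1l lawA) (alg1l lawB).
Qed.

Lemma tens_mulr1 : right_id (tens oneA oneB) tens_mul.
Proof.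
elim/tensor_ind=> [|x y IHx IHy|a b]; first by rewrite tens_mul0l.
  by rewrite tens_mulDl IHx IHy.
by rewrite tens_mulE (alg1r lawA) (alg1r lawB).
Qed.

End TensorAlgebra.

(* f p + ... + f q if p <= q, 0 if q = p - 1, and
   - f (q + 1) - ... - f (p - 1) if q < p - 1. *)
Definition sumz (M : zmodType) (p q : int) (f : int -> M) : M :=
  match q - p + 1 with
  | Posz n => \sum_(i < n) f (p + i%:Z)
  | Negz n => - \sum_(i < n.+1) f (q + 1 + i%:Z)
  end.

Notation F2 := (freegroup bool).

Definition X0 : F2 := fg_gen false.
Definition X1 : F2 := fg_gen true.

Section RootsOfUnity.
Local Open Scope complex_scope.
Notation R := Rdefinitions.R.

Variable N : nat.

(* z != 0 is automatic for N > 0. *)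
Record mu := Mu { muval : R[i]; _ : (muval != 0) && (muval ^+ N == 1) }.

HB.instance Definition _ := [isSub for muval].
HB.instance Definition _ := [Choice of mu by <:].

Lemma muval_neq0 (z : mu) : muval z != 0.
Proof. by have /andP[] := valP z. Qed.

Lemma muval_exp (z : mu) : muval z ^+ N = 1.
Proof. by have /andP[_ /eqP] := valP z. Qed.

Lemma mu_mul_subproof (z w : mu) :
  (muval z * muval w != 0) && ((muval z * muval w) ^+ N == 1).
Proof.
by rewrite mulf_neq0 ?muval_neq0 //= exprMn !muval_exp mulr1 eqxx.
Qed.

Lemma mu_inv_subproof (z : mu) :
  ((muval z)^-1 != 0) && ((muval z)^-1 ^+ N == 1).
Proof. by rewrite invr_neq0 ?muval_neq0 //= exprVn muval_exp invr1 eqxx. Qed.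

Lemma mu_one_subproof : ((1 : R[i]) != 0) && ((1 : R[i]) ^+ N == 1).
Proof. by rewrite oner_neq0 expr1n eqxx. Qed.

Definition mu_mul z w := Mu (mu_mul_subproof z w).
Definition mu_inv z := Mu (mu_inv_subproof z).
Definition mu_one := Mu mu_one_subproof.

Lemma mu_mulA : associative mu_mul.
Proof. by move=> x y z; apply: val_inj; rewrite /= mulrA. Qed.

Lemma mu_mul1 : left_id mu_one mu_mul.
Proof. by move=> x; apply: val_inj; rewrite /= mul1r. Qed.

Lemma mu_mulr1 : right_id mu_one mu_mul.
Proof. by move=> x; apply: val_inj; rewrite /= mulr1. Qed.

Lemma mu_mulV : left_inverse mu_one mu_inv mu_mul.
Proof. by move=> x; apply: val_inj; rewrite /= mulVf ?muval_neq0. Qed.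

Lemma mu_mulrV : right_inverse mu_one mu_inv mu_mul.
Proof. by move=> x; apply: val_inj; rewrite /= mulfV ?muval_neq0. Qed.

HB.instance Definition _ :=
  isGroup.Build mu mu_mulA mu_mul1 mu_mulr1 mu_mulV mu_mulrV.

Definition zeta_angle : R := 2 * Rtrigo1.PI / N%:R.

Definition zeta_val : R[i] :=
  Rtrigo_def.cos zeta_angle +i* Rtrigo_def.sin zeta_angle.

Lemma zeta_valX n : zeta_val ^+ n =
  Rtrigo_def.cos (n%:R * zeta_angle) +i* Rtrigo_def.sin (n%:R * zeta_angle).
Proof.
elim: n => [|n IHn].
  by rewrite mul0r Rtrigo_def.cos_0 Rtrigo_def.sin_0.
rewrite exprS IHn -natr1 mulrDl mul1r addrC cosD sinD /zeta_val.
by simpc; congr (_ +i* _); rewrite addrC.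
Qed.

Lemma zeta_subproof : (zeta_val != 0) && (zeta_val ^+ N == 1).
Proof.
have zN : zeta_val ^+ N = 1.
  rewrite zeta_valX; have [->|N0] := eqVneq N 0%N.
    by rewrite mul0r Rtrigo_def.cos_0 Rtrigo_def.sin_0.
  rewrite mulrC divfK ?Num.Theory.pnatr_eq0 //.
  by rewrite [Rtrigo_def.cos _]Rtrigo1.cos_2PI [Rtrigo_def.sin _]Rtrigo1.sin_2PI.
rewrite zN eqxx andbT; have [N0|N0] := eqVneq N 0%N; last first.
  by apply/eqP => z0; move: zN; rewrite z0 expr0n (negbTE N0) => /eqP;
     rewrite eq_sym oner_eq0.
rewrite /zeta_val /zeta_angle N0 invr0 mulr0 Rtrigo_def.cos_0.
by apply/eqP => -[/eqP]; rewrite oner_eq0.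
Qed.

Definition zeta : mu := Mu zeta_subproof.

Definition F2_to_mu : F2 -> mu := fg_lift (fun b => if b then 1%g else zeta).

End RootsOfUnity.

Notation VB k := (grpalg k F2).

Section AlgebraVB.
Variables (k : comPzRingType) (N : nat).

Definition augN : set (VB k) := [set f | grpalg_map (@F2_to_mu N) f = 0].

Definition filtVB (m : int) : set (VB k) :=
  if (m <= 0)%R then setT else ideal_exp augN `|m|%N.

End AlgebraVB.

Section AlgebraWB.
Variable k : comPzRingType.
Local Notation VB := (VB k).

Definition bX (x : F2) : VB := ga_base k x.

Definition inWB : {pred VB} :=
  fun f => `[< exists (c : k) (v : VB), f = c *: (1 : VB) + v * (bX X1 - 1) >].

Lemma inWBP f :
  reflect (exists (c : k) (v : VB), f = c *: (1 : VB) + v * (bX X1 - 1)) (f \in inWB).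
Proof. exact: asboolP. Qed.

Lemma inWB_subring : subring_closed inWB.
Proof.
split.
- by apply/inWBP; exists 1, 0; rewrite scale1r mul0r addr0.
- move=> _ _ /inWBP[c [v ->]] /inWBP[d [w ->]]; apply/inWBP.
  exists (c - d), (v - w).
  by rewrite scalerBl mulrBl opprD addrACA.
move=> _ _ /inWBP[c [v ->]] /inWBP[d [w ->]]; apply/inWBP.
exists (c * d), (c *: w + d *: v + v * (bX X1 - 1) * w).
rewrite mulrDl ga_scale1l [v * _ * (_ + _)]mulrDr ga_scale1r scalerDr scalerA.
by rewrite !ga_scaleAl !mulrDl -!addrA !mulrA.
Qed.

Lemma inWB_scale : GRing.scaler_closed inWB.
Proof.
move=> a _ /inWBP[c [v ->]]; apply/inWBP; exists (a * c), (a *: v).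
by rewrite scalerDr scalerA ga_scaleAl.
Qed.

HB.instance Definition _ := GRing.isSubringClosed.Build VB inWB inWB_subring.
HB.instance Definition _ := GRing.isScaleClosed.Build k VB inWB inWB_scale.

Record WB := MkWB { wbval :> VB; _ : wbval \in inWB }.

HB.instance Definition _ := [isSub for wbval].
HB.instance Definition _ := [Choice of WB by <:].
HB.instance Definition _ :=
  GRing.SubChoice_isSubPzRing.Build VB inWB WB inWB_subring.
HB.instance Definition _ := [SubZmodule_isSubLmodule of WB by <:].

Lemma WB_law : is_algebra_law (1 : WB) *%R.
Proof.
split; [exact: mulrA | exact: mul1r | exact: mulr1 | exact: mulrDl
       | exact: mulrDr | |] => c a b; apply: val_inj.
- by rewrite rmorphM !linearZ rmorphM /= ga_scaleAl.
- by rewrite rmorphM !linearZ rmorphM /= ga_scaleAr.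
Qed.

Local Notation WWB := (tensor WB WB).
HB.instance Definition _ := GRing.Zmodule_isPzRing.Build (tensor WB WB)
  (tens_mulA WB_law WB_law) (tens_mul1 WB_law WB_law) (tens_mulr1 WB_law WB_law)
  (tens_mulDl WB_law WB_law) (tens_mulDr WB_law WB_law).

Lemma tens_WB_M (a b a' b' : WB) :
  (tens a b : WWB) * tens a' b' = tens (a * a') (b * b').
Proof. exact: (tens_mulE WB_law WB_law). Qed.

Lemma inWB_X1V : bX X1^-1%g \in inWB.
Proof.
apply/inWBP; exists 1, (- bX X1^-1%g).
rewrite scale1r mulNr mulrBr mulr1 -ga_baseM mulVg opprB.
by rewrite addrC subrK.
Qed.

Lemma inWB_mulX1 (v : VB) : v * (bX X1 - 1) \in inWB.
Proof. by apply/inWBP; exists 0, v; rewrite scale0r add0r. Qed.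

Definition WB_X1V : WB := MkWB inWB_X1V.

Definition WB_gen (n : int) : WB := MkWB (inWB_mulX1 (bX (gexpz X0 n))).

Definition inX (w : WB) : WWB := tens w (1 : WB).
Definition inY (w : WB) : WWB := tens (1 : WB) w.

Definition filtWB (N : nat) (m : int) : set WB :=
  [set w | filtVB N m (wbval w)].

Definition filtWWB (N : nat) (m : int) : set WWB :=
  tens_filtration (filtWB N) (filtWB N) m.

(* These values determine Delta, as X1^-1 and the X0^n (X1 - 1) generate WB. *)
Definition is_DeltaWB (Delta : WB -> WWB) : Prop :=
  [/\ linear Delta, monoid_morphism Delta,
      Delta WB_X1V = inX WB_X1V * inY WB_X1V &
      forall n : int,
        Delta (WB_gen n) = inX (WB_gen n) + inY (WB_gen n) -
          sumz 1 (n - 1) (fun i => inX (WB_gen i) * inY (WB_gen (n - i)))].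

End AlgebraWB.

(* Main.v *)
(* Write t = X0^p - 1 and u = X1 - 1, where p is the order of zeta_N, and let I
   be the kernel of k[F_2] -> k[mu_N].
   The Fox derivative d with respect to X1 satisfies d(vu) = v and
   d(fg) = f d(g) for g in I, so vu in I^(n+1) forces v in I^n: in positive
   degree n + 1 the filtration of W is I^n u.
   The coproduct of t^b X0^n u is obtained by taking b step-p differences in n.
   Each difference turns the convolution of two generators into the convolution
   with one more factor t on the right, plus p boundary terms on which the
   remaining differences put their factors t on the left; hence the result lies
   in degree b + 1.
   Finally, the elements v such that every Delta(t^b X0^n v) is defined and lies
   in degree c + b form a left k[F_2]-module M_c; u lies in M_1, and I M_c is
   contained in M_(c+1) because I is the two-sided ideal generated by t and u.
   Hence I^n u is contained in M_(n+1). *)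
From HB Require Import structures.
From mathcomp Require Import all_boot all_order all_algebra.
From mathcomp Require Import finmap classical_sets monalg complex Rstruct.
From mathcomp Require Import zify.
Require Import Defs.

Set Implicit Arguments.
Unset Strict Implicit.
Unset Printing Implicit Defensive.

Import GRing.Theory.

Local Open Scope ring_scope.
Local Open Scope classical_set_scope.

(** * Submodules and spans *)

Section Span.
Variables (k : comPzRingType) (M : lmodType k).
Implicit Types (S P : set M).

Definition submodule P := P 0 /\ forall c x y, P x -> P y -> P (c *: x + y).

Lemma submoduleD P x y : submodule P -> P x -> P y -> P (x + y).
Proof. by move=> [_ PL] Px Py; rewrite -[x]scale1r; apply: PL. Qed.

Lemma submoduleZ P c x : submodule P -> P x -> P (c *: x).
Proof. by move=> [P0 PL] Px; rewrite -[_ *: _]addr0; apply: PL. Qed.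

Lemma submoduleB P x y : submodule P -> P x -> P y -> P (x - y).
Proof.
move=> subP Px Py; apply: submoduleD => //.
by rewrite -scaleN1r; apply: submoduleZ.
Qed.

Lemma submodule_sum P (I : Type) (r : seq I) (F : I -> M) :
  submodule P -> (forall i, P (F i)) -> P (\sum_(i <- r) F i).
Proof.
move=> subP PF; elim/big_ind: _ => [|x y|//]; first by case: subP.
exact: submoduleD.
Qed.

Lemma submodule_sumz P (p q : int) (f : int -> M) :
  submodule P -> (forall i, P (f i)) -> P (sumz p q f).
Proof.
move=> subP Pf; rewrite /sumz; case: (_ + 1) => n; first exact: submodule_sum.
by rewrite -scaleN1r; apply: submoduleZ => //; apply: submodule_sum.
Qed.

Lemma sub_span S : S `<=` span S.
Proof.
move=> x Sx; exists 1%N, (fun=> 1), (fun=> x); split=> //.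
by rewrite big_ord1 scale1r.
Qed.

Lemma submodule_span S : submodule (span S).
Proof.
split=> [|a x y [n [c [v [Sv ->]]]] [m [d [w [Sw ->]]]]].
  by exists 0%N, (fun=> 0), (fun=> 0); split=> [[]|] //; rewrite big_ord0.
exists (n + m)%N.
exists (fun i => match split i with inl j => a * c j | inr j => d j end).
exists (fun i => match split i with inl j => v j | inr j => w j end).
split=> [i|]; first by case: (split i).
rewrite scaler_sumr big_split_ord /=; congr (_ + _); apply: eq_bigr => i _.
  by rewrite -/(unsplit (inl i)) unsplitK scalerA.
by rewrite -/(unsplit (inr i)) unsplitK.
Qed.

Lemma span_sub S P : submodule P -> S `<=` P -> span S `<=` P.
Proof.
move=> subP SP x [n [c [v [Sv ->]]]]; apply: submodule_sum => // i.
by apply: submoduleZ => //; apply: SP.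
Qed.

End Span.

Lemma submodule_preim (k : comPzRingType) (M L : lmodType k)
    (f : {linear M -> L}) (P : set L) :
  submodule P -> submodule (f @^-1` P).
Proof.
by case=> P0 PL; split=> [|c x y Px Py] /=; rewrite ?linear0 ?linearP; auto.
Qed.

(** * Sums with integer bounds and integer powers in a group *)

Lemma sumz_rec (M : zmodType) (p q : int) (f : int -> M) :
  sumz p (q + 1) f = sumz p q f + f (q + 1).
Proof.
rewrite /sumz.
have -> : q + 1 - p + 1 = (q - p + 1) + 1 by lia.
case E: (q - p + 1) => [n|[|n]].
- rewrite -PoszD addn1 big_ord_recr /=; congr (_ + f _); lia.
- by rewrite /= big_ord0 big_ord1 [_ + Posz (nat_of_ord _)]addr0 addNr.
- have -> : Negz n.+1 + 1 = Negz n by lia.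
  rewrite [in RHS]big_ord_recl [_ + Posz (nat_of_ord _)]addr0 opprD.
  rewrite [RHS]addrAC addNr add0r.
  by congr (- _); apply: eq_bigr => i _; congr f; rewrite lift0; lia.
Qed.

(** The sign convention for reversed bounds makes [sumz_rec] hold for all integers p and q, so no
    case split on the sign of q - p is left here. *)
Lemma sumz_catr (M : zmodType) (p q : int) (n : nat) (f : int -> M) :
  sumz p (q + n%:Z - 1) f = sumz p (q - 1) f + \sum_(i < n) f (q + i%:Z).
Proof.
elim: n => [|n IHn]; first by rewrite big_ord0 !addr0.
rewrite big_ord_recr addrA -IHn /=.
have -> : q + n.+1%:Z - 1 = (q + n%:Z - 1) + 1 by lia.
by rewrite sumz_rec subrK.
Qed.

Lemma sumzB (M : zmodType) (p q : int) (f g : int -> M) :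
  sumz p q f - sumz p q g = sumz p q (fun i => f i - g i).
Proof.
by rewrite /sumz; case: (_ + 1) => n; rewrite sumrB // opprB opprK addrC.
Qed.

Lemma eq_sumz (M : zmodType) (p q : int) (f g : int -> M) :
  f =1 g -> sumz p q f = sumz p q g.
Proof.
by move=> fg; rewrite /sumz; case: (_ + 1) => n; under eq_bigr do rewrite fg.
Qed.

Lemma gexpzS (G : groupType) (x : G) (n : int) :
  gexpz x (1 + n) = (x * gexpz x n)%g.
Proof.
case: n => [n|[|n]]; first by rewrite /= add1n expgS.
  by rewrite /= expg1 mulgV.
have -> : 1 + Negz n.+1 = Negz n by lia.
by rewrite /= [in RHS]expgSr invgM mulVKg.
Qed.

Lemma gexpzD (G : groupType) (x : G) (m n : int) :
  gexpz x (m + n) = (gexpz x m * gexpz x n)%g.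
Proof.
elim/int_ind: m => [|m IHm|m IHm]; first by rewrite add0r mul1g.
  have -> : m.+1%:Z = 1 + m%:Z by lia.
  by rewrite -addrA !gexpzS IHm mulgA.
apply: (mulgI x).
rewrite mulgA -!gexpzS.
have -> : 1 + (- m.+1%:Z + n) = - m%:Z + n by lia.
by have -> : 1 - m.+1%:Z = - m%:Z by lia.
Qed.

(** * Induction on the letters of a free group element *)

Section FreeGroup.
Variable S : choiceType.
Local Notation F := (freegroup S).

(** In a reduced word the first letter does not cancel against the rest, so multiplying the tail by
    that letter restores the word. *)
Lemma freegroup_ind (P : F -> Prop) :
  P 1%g -> (forall s x, P x -> P (fg_gen s * x)%g) ->
  (forall s x, P x -> P ((fg_gen s)^-1 * x)%g) -> forall x, P x.
Proof.
move=> P1 Pgen Pinv [w red_w]; elim: w red_w => [|[s b] w IHw] red_w.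
  by have -> : FreeGroup red_w = 1%g by apply: val_inj.
have red_w' : reduced w by case: w red_w {IHw} => //= l w /andP[].
have push_w : push (s, b) w = (s, b) :: w.
  by case: w red_w {IHw red_w'} => //= l w /andP[/negbTE ->].
case: b red_w push_w => red_w push_w.
  have -> : FreeGroup red_w = (fg_gen s * FreeGroup red_w')%g.
    exact: val_inj.
  exact/Pgen/IHw.
have -> : FreeGroup red_w = ((fg_gen s)^-1 * FreeGroup red_w')%g.
  exact: val_inj.
exact/Pinv/IHw.
Qed.

End FreeGroup.

(** * Linear extension of maps from a group to its group algebra *)

Section LinearExtension.
Variables (k : comPzRingType) (G : groupType) (M : lmodType k).
Implicit Types (h : G -> M) (f : grpalg k G).

Definition ga_lin h f : M := \sum_(x <- msupp f) f@_x *: h x.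

(** Enlarging the index set only adds zero coefficients; over a set common to several elements,
    linearity can be checked termwise. *)
Lemma ga_linw h (d : {fset G}) f : (msupp f `<=` d)%fset ->
  ga_lin h f = \sum_(x <- d) f@_x *: h x.
Proof.
move=> le_d; apply/big_fset_incl => // x _ /mcoeff_outdom ->.
by rewrite scale0r.
Qed.

Lemma ga_lin_is_linear h : linear (ga_lin h).
Proof.
move=> c f g; pose d := (msupp (c *: f + g) `|` (msupp f `|` msupp g))%fset.
rewrite (@ga_linw h d f) ?(@ga_linw h d g) ?(@ga_linw h d (c *: f + g)).
- rewrite scaler_sumr -big_split /=; apply: eq_bigr => x _.
  by rewrite mcoeffD [(c *: f)@_x]ga_scaleE scalerDl scalerA.
- exact: fsubsetUl.
- by apply/fsubsetP => x; rewrite !inE => ->; rewrite !orbT.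
- by apply/fsubsetP => x; rewrite !inE => ->; rewrite !orbT.
Qed.

HB.instance Definition _ h :=
  GRing.isLinear.Build k (grpalg k G) M *:%R (ga_lin h) (ga_lin_is_linear h).

Lemma ga_linU h c x : ga_lin h (<< c *g x >> : grpalg k G) = c *: h x.
Proof. by rewrite (ga_linw h msuppU_le) big_seq_fset1 mcoeffUU. Qed.

Lemma ga_lin_base h x : ga_lin h (ga_base k x) = h x.
Proof. by rewrite ga_base.unlock ga_linU scale1r. Qed.

Lemma ga_lin_in (P : set M) h f :
  submodule P -> (forall x, P (h x)) -> P (ga_lin h f).
Proof. by move=> subP Ph; apply: submodule_sum => // x; apply: submoduleZ. Qed.

End LinearExtension.

Section GroupAlgebra.
Variables (k : comPzRingType) (G : groupType).
Implicit Types (f g : grpalg k G).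

Lemma ga_baseE c (x : G) : (<< c *g x >> : grpalg k G) = c *: ga_base k x.
Proof. by rewrite ga_base.unlock ga_scaleU mulr1. Qed.

Lemma ga_base1 : ga_base k (1%g : G) = 1.
Proof. by []. Qed.

Lemma ga_base_ind (P : grpalg k G -> Prop) :
  submodule P -> (forall x, P (ga_base k x)) -> forall f, P f.
Proof.
move=> subP Pb; apply: grpalg_ind => [|f g|c x]; first by case: subP.
  exact: submoduleD.
by rewrite ga_baseE; apply: submoduleZ.
Qed.

Lemma ga_lin_id f : ga_lin (@ga_base k G) f = f.
Proof. by rewrite [RHS]monalgE; apply: eq_bigr => x _; rewrite ga_baseE. Qed.

End GroupAlgebra.

Lemma grpalg_mapE (k : comPzRingType) (G H : groupType) (phi : G -> H)
    (f : grpalg k G) :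
  grpalg_map phi f = ga_lin (fun x => ga_base k (phi x)) f.
Proof. by apply: eq_bigr => x _; rewrite ga_baseE. Qed.

Lemma ga_lin_map (k : comPzRingType) (G H : groupType) (M : lmodType k)
    (phi : G -> H) (h : H -> M) (f : grpalg k G) :
  ga_lin h (grpalg_map phi f) = ga_lin (h \o phi) f.
Proof.
rewrite grpalg_mapE linear_sum; apply: eq_bigr => x _.
by rewrite linearZ /= ga_lin_base.
Qed.

Section GroupAlgebraMorphisms.
Variables (k : comPzRingType) (G H : groupType).

Lemma submodule_mull (P : set (grpalg k G)) (g : grpalg k G) :
  submodule P -> submodule [set f | P (g * f)].
Proof.
case=> P0 PL; split=> [|c x y Px Py] /=; first by rewrite mulr0.
by rewrite mulrDr -ga_scaleAr; apply: PL.
Qed.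

Lemma submodule_mulr (P : set (grpalg k G)) (g : grpalg k G) :
  submodule P -> submodule [set f | P (f * g)].
Proof.
case=> P0 PL; split=> [|c x y Px Py] /=; first by rewrite mul0r.
by rewrite mulrDl -ga_scaleAl; apply: PL.
Qed.

Lemma ga_linM (h : G -> grpalg k H) : {morph h : x y / (x * y)%g >-> x * y} ->
  {morph ga_lin h : f g / f * g}.
Proof.
move=> hM f g; elim/ga_base_ind: f => [|x].
  split=> [|c x y /= IHx IHy]; first by rewrite /= !(mul0r, linear0).
  by rewrite mulrDl -ga_scaleAl !linearP /= IHx IHy mulrDl -ga_scaleAl.
elim/ga_base_ind: g => [|y].
  split=> [|c x' y /= IHx IHy]; first by rewrite /= !(mulr0, linear0).
  by rewrite mulrDr -ga_scaleAr !linearP /= IHx IHy mulrDr -ga_scaleAr.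
by rewrite -ga_baseM !ga_lin_base hM.
Qed.

End GroupAlgebraMorphisms.

(** * Powers of the kernel I of the map to the group algebra of the roots of unity *)

Section Filtration.
Variables (k : comPzRingType) (N : nat).
Local Notation VB := (VB k).
Local Notation I := (@augN k N).
Local Notation phi := (@F2_to_mu N).
Local Notation FV n := (@filtVB k N n%:Z).
Implicit Types (f g v : VB).

Lemma F2_to_muM : {morph phi : x y / (x * y)%g}.
Proof. exact: (fg_lift_is_morphism _).2. Qed.

Lemma F2_to_mu1 : phi 1%g = 1%g.
Proof. exact: (fg_lift_is_morphism _).1. Qed.

Lemma F2_to_muX (x : F2) n : phi (x ^+ n)%g = (phi x ^+ n)%g.
Proof.
by elim: n => [|n IHn]; rewrite ?expg0 ?F2_to_mu1 // !expgS F2_to_muM IHn.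
Qed.

Lemma augNE f : I f = (ga_lin (fun x => ga_base k (phi x)) f = 0).
Proof. by rewrite /augN /= grpalg_mapE. Qed.

(** The linear extension factors through the group algebra of mu_N. This serves both for the
    augmentation and for coset representatives. *)
Lemma augN_lin (M : lmodType k) (h : mu N -> M) f :
  I f -> ga_lin (h \o phi) f = 0.
Proof. by rewrite -ga_lin_map => ->; rewrite linear0. Qed.

Lemma augN_mul f g : I f \/ I g -> I (f * g).
Proof.
rewrite !augNE ga_linM => [[] ->|x y]; rewrite ?(mul0r, mulr0) //.
by rewrite F2_to_muM ga_baseM.
Qed.

Lemma augN_sub x y : phi x = phi y -> I (bX k x - bX k y).
Proof. by move=> xy; rewrite augNE linearB /= !ga_lin_base xy subrr. Qed.

Lemma filtVB_nat n : FV n = if n is 0 then setT else ideal_exp I n.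
Proof. by case: n. Qed.

Lemma submodule_filtVB m : submodule (@filtVB k N m).
Proof.
by rewrite /filtVB; case: ifP => _; [split | apply: submodule_span].
Qed.

Lemma filtVB_prod n (v : 'I_n -> VB) :
  (forall i, I (v i)) -> FV n (\prod_i v i).
Proof.
by case: n v => [|n] v Iv; rewrite filtVB_nat //; apply: sub_span; exists v.
Qed.

Lemma augN_filtVB f : I f -> FV 1 f.
Proof.
by move=> If; have := @filtVB_prod 1 (fun=> f) (fun=> If); rewrite big_ord1.
Qed.

(** Since I is a two-sided ideal, the extra factor can be absorbed into the adjacent end of a
    product of elements of I; degree 0 is everything. *)
Lemma filtVB_mul_setT n f g : FV n f \/ FV n g -> FV n (f * g).
Proof.
have subFV := submodule_filtVB n%:Z.
case: n subFV => [|n] subFV; first by rewrite filtVB_nat.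
case; rewrite {1}filtVB_nat.
  apply: (span_sub (submodule_mulr g subFV)) => _ [v [Iv ->]] /=.
  rewrite big_ord_recr /= -mulrA.
  pose w i := if unlift ord_max i is Some j then v (widen_ord (leqnSn n) j)
              else v ord_max * g.
  have Iw i : I (w i).
    by rewrite /w; case: unliftP => // _; apply: augN_mul; left.
  suff -> : \prod_(i < n) v (widen_ord (leqnSn n) i) * (v ord_max * g) =
      \prod_i w i.
    exact: filtVB_prod.
  rewrite big_ord_recr /= /w unlift_none; congr (_ * _).
  apply: eq_bigr => i _; have E : widen_ord (leqnSn n) i = lift ord_max i.
    by apply: val_inj; rewrite /= /bump leqNgt ltn_ord.
  by rewrite [in RHS]E liftK.
apply: (span_sub (submodule_mull f subFV)) => _ [v [Iv ->]] /=.
rewrite big_ord_recl mulrA.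
pose w i := if unlift ord0 i is Some j then v (lift ord0 j) else f * v ord0.
have Iw i : I (w i).
  by rewrite /w; case: unliftP => // _; apply: augN_mul; right.
suff -> : f * v ord0 * \prod_(i < n) v (lift ord0 i) = \prod_i w i.
  exact: filtVB_prod.
rewrite big_ord_recl /= /w unlift_none; congr (_ * _).
by apply: eq_bigr => i _; rewrite liftK.
Qed.

Lemma filtVBM i j f g : FV i f -> FV j g -> FV (i + j) (f * g).
Proof.
case: i => [_ Fg|i]; first by apply: filtVB_mul_setT; right.
case: j => [Ff _|j]; first by rewrite addn0; apply: filtVB_mul_setT; left.
have subFV := submodule_filtVB (i.+1 + j.+1)%N%:Z.
rewrite 2!filtVB_nat => + Fg.
apply: (span_sub (submodule_mulr g subFV)) => _ [v [Iv ->]] /=; move: g Fg.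
apply: (span_sub (submodule_mull _ subFV)) => _ [w [Iw ->]] /=.
pose z l := match split l with inl a => v a | inr b => w b end.
suff -> : \prod_a v a * \prod_b w b = \prod_l z l.
  by apply: filtVB_prod => l; rewrite /z; case: (split l).
rewrite big_split_ord; congr (_ * _); apply: eq_bigr => l _; rewrite /z.
  by rewrite -/(unsplit (inl l)) unsplitK.
by rewrite -/(unsplit (inr l)) unsplitK.
Qed.

(** Peels off the first factor; the mirror version [filtVBSr] suits [fox] and [counit], where the
    last factor is the one known to have augmentation 0. *)
Lemma filtVBSl (P : set VB) n : submodule P ->
  (forall f g, I f -> FV n g -> P (f * g)) -> FV n.+1 `<=` P.
Proof.
move=> subP IP; rewrite filtVB_nat; apply: span_sub => // _ [v [Iv ->]].
by rewrite big_ord_recl; apply/IP/filtVB_prod.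
Qed.

Lemma filtVBSr (P : set VB) n : submodule P ->
  (forall f g, FV n f -> I g -> P (f * g)) -> FV n.+1 `<=` P.
Proof.
move=> subP IP; rewrite filtVB_nat; apply: span_sub => // _ [v [Iv ->]].
by rewrite big_ord_recr; apply/IP => //; apply: filtVB_prod.
Qed.

Lemma filtVB_anti i j : (i <= j)%N -> FV j `<=` FV i.
Proof.
move=> /subnK <-; elim: (j - i)%N => // n IHn; apply: subset_trans IHn.
rewrite addSn; apply: filtVBSl => [|f g _ Fg]; first exact: submodule_filtVB.
by apply: filtVB_mul_setT; right.
Qed.

Lemma filtVB_le (i : int) (j : nat) : (i <= j%:Z)%R -> FV j `<=` filtVB N i.
Proof.
case: i => [i|i] le_ij; first exact: filtVB_anti.
by rewrite {2}/filtVB.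
Qed.

End Filtration.

(** * Fox calculus and the positive part of the filtration of [WB] *)

Section FoxDerivative.
Variable k : comPzRingType.
Local Notation VB := (VB k).
Local Notation u := (bX k X1 - 1).
Implicit Types (x y : F2) (f g v : VB).

(** The value at X1^-1 is forced by the product rule applied to X1 X1^-1 = 1. *)
Definition fox_letter (l : bool * bool) : VB :=
  if l.1 then (if l.2 then 1 else - bX k X1^-1%g) else 0.

Definition letter (l : bool * bool) : F2 :=
  if l.2 then fg_gen l.1 else (fg_gen l.1)^-1%g.

Fixpoint fox_word (w : seq (bool * bool)) : VB :=
  if w is l :: w' then bX k (letter l) * fox_word w' + fox_letter l else 0.

(** If [l] cancels against the first letter of [w], their contributions cancel too, so reducing a
    word does not change its derivative. *)
Lemma fox_word_push l w :
  fox_word (push l w) = bX k (letter l) * fox_word w + fox_letter l.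
Proof.
case: w => [|l' w] //=; case: eqVneq => [->|_] //=.
have letterV : (letter l * letter (linv l) = 1)%g.
  by case: l => s []; rewrite /letter /= ?mulgV ?mulVg.
rewrite mulrDr mulrA -ga_baseM letterV ga_base1 mul1r -addrA.
rewrite [X in _ + X](_ : _ = 0) ?addr0 //.
case: l {letterV} => -[] []; rewrite /fox_letter /letter /= ?mulr0 ?addr0 //.
  by rewrite mulrN -ga_baseM mulgV addNr.
by rewrite mulr1 subrr.
Qed.

(* The Fox derivative with respect to X1: the coefficient of X1 - 1 of an
   element of the augmentation ideal, a free left module on X0 - 1, X1 - 1. *)
Definition fox : VB -> VB := ga_lin (fun x => fox_word (fgword x)).
HB.instance Definition _ := GRing.Linear.on fox.

(** The augmentation, with values in the scalars of [VB] so that [ga_linM] applies to it. *)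
Definition counit : VB -> VB := ga_lin (fun=> 1 : VB).
HB.instance Definition _ := GRing.Linear.on counit.

Lemma fox_base x : fox (bX k x) = fox_word (fgword x).
Proof. exact: ga_lin_base. Qed.

Lemma counit_base x : counit (bX k x) = 1.
Proof. exact: ga_lin_base. Qed.

Lemma bX_one : bX k 1%g = 1.
Proof. by []. Qed.

Lemma fox_baseM x y :
  fox (bX k (x * y)%g) = bX k x * fox (bX k y) + fox (bX k x).
Proof.
rewrite !fox_base.
elim/freegroup_ind: x => [|s x IHx|s x IHx].
- by rewrite mul1g bX_one mul1r /= addr0.
- rewrite -mulgA.
  rewrite [LHS](fox_word_push (s, true)).
  rewrite [X in _ = _ + X](fox_word_push (s, true)).
  by rewrite {}IHx mulrDr -addrA /bX ga_baseM mulrA.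
rewrite -mulgA.
rewrite [LHS](fox_word_push (s, false)).
rewrite [X in _ = _ + X](fox_word_push (s, false)).
by rewrite {}IHx mulrDr -addrA /bX ga_baseM mulrA.
Qed.

Lemma foxM f g : fox (f * g) = f * fox g + fox f * counit g.
Proof.
elim/ga_base_ind: f => [|x].
  split=> [|c x y /= IHx IHy]; first by rewrite /= !(mul0r, linear0) addr0.
  rewrite mulrDl -ga_scaleAl !linearP /= IHx IHy !mulrDl -!ga_scaleAl scalerDr.
  by rewrite addrACA.
elim/ga_base_ind: g => [|y].
  split=> [|c y z /= IHx IHy]; first by rewrite /= !(mulr0, linear0) addr0.
  rewrite mulrDr -ga_scaleAr !linearP /= IHx IHy !mulrDr -!ga_scaleAr scalerDr.
  by rewrite addrACA.
by rewrite -ga_baseM fox_baseM counit_base mulr1.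
Qed.

Lemma counit_u : counit u = 0.
Proof. by rewrite linearB -bX_one /= !counit_base subrr. Qed.

Lemma fox_u : fox u = 1.
Proof.
rewrite linearB -[X in _ - _ X]bX_one /= !fox_base /=.
by rewrite mulr0 add0r subr0.
Qed.

Lemma fox_mulu v : fox (v * u) = v.
Proof. by rewrite foxM fox_u counit_u mulr0 addr0 mulr1. Qed.

Lemma counitM : {morph counit : f g / f * g}.
Proof. by apply: ga_linM => x y; rewrite mulr1. Qed.

Lemma counit_augN N f : augN N f -> counit f = 0.
Proof. exact: (@augN_lin k N VB (fun=> 1 : VB)). Qed.

Lemma filtVB_mulu N n v : filtVB N n.+1%:Z (v * u) -> filtVB N n%:Z v.
Proof.
rewrite -{2}[v]fox_mulu.
apply: (filtVBSr (P := fox @^-1` _)) => [|f g Ff Ig] /=.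
  exact: submodule_preim (submodule_filtVB k N n%:Z).
rewrite foxM (counit_augN Ig) mulr0 addr0.
by apply: filtVB_mul_setT; left.
Qed.

(** Elements of positive degree have augmentation 0, and so does u; hence the scalar part c of w
    vanishes. *)
Lemma filtWB_mulu N n (w : WB k) : filtWB N n.+1%:Z w ->
  exists2 v, wbval w = v * u & filtVB N n%:Z v.
Proof.
rewrite /filtWB /= => Fw.
have /inWBP[c [v w_eq]] := valP w.
have eps0 : counit (wbval w) = 0.
  move: Fw; apply: (filtVBSr (P := counit @^-1` [set 0])) => [|f g _ Ig] /=.
    by apply: submodule_preim; split=> // a x y -> ->; rewrite scaler0 addr0.
  by rewrite counitM (counit_augN Ig) mulr0.
have c0 : c *: (1 : VB) = 0.
  have := eps0; rewrite [wbval w]w_eq linearD /= counitM counit_u mulr0 addr0.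
  by rewrite linearZ -bX_one /= counit_base.
exists v; first by rewrite [LHS]w_eq c0 add0r.
by apply: filtVB_mulu; rewrite -[_ * _]add0r -c0 -w_eq.
Qed.

End FoxDerivative.

(** * The filtration of the tensor square *)

Section Tensor.
Variables (k : comPzRingType) (N : nat).
Local Notation W := (WB k).
Local Notation WW := (tensor (WB k) (WB k)).
Local Notation FW n := (@filtWB k N n%:Z).

Lemma tensNl (A B : lmodType k) (a : A) (b : B) : tens (- a) b = - tens a b.
Proof. by rewrite -scaleN1r tensZl scaleN1r. Qed.

Lemma tensNr (A B : lmodType k) (a : A) (b : B) : tens a (- b) = - tens a b.
Proof. by rewrite -scaleN1r tensZr scaleN1r. Qed.

Lemma tens_scaleAl c (x y : WW) : (c *: x) * y = c *: (x * y).
Proof.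
elim/tensor_ind: x => [|x x' IHx IHx'|a b].
- by rewrite mul0r !scaler0 mul0r.
- by rewrite !(scalerDr, mulrDl) IHx IHx'.
elim/tensor_ind: y => [|y y' IHy IHy'|a' b']; first by rewrite !mulr0 scaler0.
  by rewrite !(scalerDr, mulrDr) IHy IHy'.
by rewrite -tensZl !tens_WB_M -tensZl (algZl (WB_law k)).
Qed.

Lemma tens_scaleAr c (x y : WW) : x * (c *: y) = c *: (x * y).
Proof.
elim/tensor_ind: x => [|x x' IHx IHx'|a b]; first by rewrite !mul0r scaler0.
  by rewrite !(scalerDr, mulrDl) IHx IHx'.
elim/tensor_ind: y => [|y y' IHy IHy'|a' b'].
- by rewrite !(mulr0, scaler0).
- by rewrite !(scalerDr, mulrDr) IHy IHy'.
by rewrite -tensZl !tens_WB_M -tensZl (algZr (WB_law k)).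
Qed.

(* Natural-number indices suffice: the filtration is constant in degrees <= 0.
   Asking for [c <= i + j] makes it decreasing by construction. *)
Definition filtWW (c : nat) : set WW :=
  span [set z | exists i j a b,
    [/\ (c <= i + j)%N, FW i a, FW j b & z = tens a b]].

Lemma submodule_filtWW c : submodule (filtWW c).
Proof. exact: submodule_span. Qed.

Lemma filtWW_tens i j c a b :
  FW i a -> FW j b -> (c <= i + j)%N -> filtWW c (tens a b).
Proof. by move=> Fa Fb le_c; apply: sub_span; exists i, j, a, b. Qed.

Lemma filtWW_anti c d : (c <= d)%N -> filtWW d `<=` filtWW c.
Proof.
move=> le_cd; apply: (span_sub (submodule_filtWW c)) => _
  [i [j [a [b [le_d Fa Fb ->]]]]].
exact: filtWW_tens Fa Fb (leq_trans le_cd le_d).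
Qed.

Lemma filtWWM c d x y : filtWW c x -> filtWW d y -> filtWW (c + d) (x * y).
Proof.
have [F0 FL] := submodule_filtWW (c + d).
move=> + Fy; apply: (span_sub (P := [set x | filtWW (c + d) (x * y)])).
  split=> [|e x1 x2 Fx1 Fx2] /=; first by rewrite mul0r.
  by rewrite mulrDl tens_scaleAl; apply: FL.
move=> _ [i [j [a [b [le_c Fa Fb ->]]]]] /=; move: y Fy.
apply: (span_sub (P := [set y | filtWW (c + d) (_ * y)])).
  split=> [|e y1 y2 Fy1 Fy2] /=; first by rewrite mulr0.
  by rewrite mulrDr tens_scaleAr; apply: FL.
move=> _ [i' [j' [a' [b' [le_d Fa' Fb' ->]]]]] /=.
rewrite tens_WB_M.
apply: (@filtWW_tens (i + i') (j + j')); last by lia.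
  exact: filtVBM Fa Fa'.
exact: filtVBM Fb Fb'.
Qed.

Lemma filtWW_sub c : filtWW c `<=` filtWWB N c%:Z.
Proof.
apply: (span_sub (submodule_span _)) => _ [i [j [a [b [le_c Fa Fb ->]]]]].
(* The degree c - i may be negative; it is at most j, and the filtration decreases, so b still
   qualifies. *)
apply: sub_span; exists i%:Z, (c%:Z - i%:Z); split; first by lia.
apply: sub_span; exists a, b; split=> //.
by apply: (@filtVB_le k N (c%:Z - i%:Z) j) => //; lia.
Qed.

Lemma filtWWB_le0 (m : int) (x : WW) : (m <= 0)%R -> filtWWB N m x.
Proof.
move=> m_le0; elim/tensor_ind: x => [|x y|a b].
- exact: (submodule_span _).1.
- exact: (submoduleD (submodule_span _)).
(* In the degrees m <= 0 and 0 the filtration of [WB] is everything. *)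
apply: sub_span; exists m, 0; split; first by rewrite addr0.
by apply: sub_span; exists a, b; split; rewrite // /filtWB /= /filtVB ?m_le0.
Qed.

End Tensor.

(** * Coproduct of the iterated differences of the generators *)

Section Coproduct.
Variables (k : comPzRingType) (N p : nat).
Hypothesis zeta_prim : p.-primitive_root (muval (zeta N)).
Variable Delta : WB k -> tensor (WB k) (WB k).
Hypothesis DeltaP : is_DeltaWB Delta.
Local Notation W := (WB k).
Local Notation WW := (tensor (WB k) (WB k)).
Local Notation FW n := (@filtWB k N n%:Z).
Local Notation FWW := (@filtWW k N).
Local Notation u := (bX k X1 - 1).
Local Notation t := (bX k (X0 ^+ p)%g - 1).
Local Notation x0 n := (bX k (gexpz X0 n)).

(** Left multiplication by t acts on the index n as the step-p difference, so this is the b-fold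
    difference of [WB_gen]. *)
Definition WB_gen_diff (b : nat) (n : int) : W :=
  MkWB (inWB_mulX1 (t ^+ b * x0 n)).
Local Notation T := WB_gen_diff.

Lemma WB_gen_diff0 n : T 0 n = WB_gen k n.
Proof. by apply: val_inj; rewrite /= expr0 mul1r. Qed.

Lemma WB_gen_diffS b n : T b.+1 n = T b (n + p%:Z) - T b n.
Proof.
apply: val_inj; rewrite /= -mulrBl -mulrBr exprSr; congr (_ * _).
by rewrite -mulrA mulrBl mul1r /bX -ga_baseM [n + _]addrC gexpzD.
Qed.

Lemma F2_to_mu_X0 : F2_to_mu N X0 = zeta N.
Proof. exact: fg_lift_gen. Qed.

Lemma F2_to_mu_X1 : F2_to_mu N X1 = 1%g.
Proof. exact: fg_lift_gen. Qed.

Lemma muvalX (z : mu N) n : muval (z ^+ n)%g = muval z ^+ n.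
Proof. by elim: n => [//|n IHn]; rewrite expgS exprS -IHn. Qed.

Lemma zeta_p : (zeta N ^+ p = 1)%g.
Proof. by apply: val_inj; rewrite /= muvalX (prim_expr_order zeta_prim). Qed.

Lemma zeta_inj (i j : 'I_p) : (zeta N ^+ i = zeta N ^+ j)%g -> i = j.
Proof.
move=> /(congr1 (@muval N)) /eqP.
by rewrite !muvalX (eq_prim_root_expr zeta_prim) !modn_small // => /eqP/val_inj.
Qed.

Lemma augN_t : @augN k N t.
Proof.
rewrite -bX_one; apply: augN_sub.
by rewrite F2_to_muX F2_to_mu_X0 zeta_p F2_to_mu1.
Qed.

Lemma augN_u : @augN k N u.
Proof. by rewrite -bX_one; apply: augN_sub; rewrite F2_to_mu_X1 F2_to_mu1. Qed.

Lemma filtWB_gen_diff b n : FW b.+1 (T b n).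
Proof.
rewrite /filtWB /= -addn1; apply: filtVBM (augN_filtVB augN_u).
apply: filtVB_mul_setT; left; elim: b => [//|b IHb].
by rewrite exprSr -addn1; apply: filtVBM IHb (augN_filtVB augN_t).
Qed.

(** Here [b] counts the differences still to be applied to the whole convolution, and [c] those
    already carried by its right factor. *)
Fixpoint conv_diff (b c : nat) (n : int) : WW :=
  if b is b'.+1 then conv_diff b' c (n + p%:Z) - conv_diff b' c n
  else sumz 1 (n - 1) (fun i => tens (T 0 i) (T c (n - i))).

(* Leibniz rule: the difference of a convolution is the convolution with the
   difference of the right factor, plus boundary terms. *)
Lemma conv_diffS b c n : conv_diff b.+1 c n =
  conv_diff b c.+1 n + \sum_(i < p) tens (T b (n + i%:Z)) (T c (p%:Z - i%:Z)).
Proof.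
elim: b n => [|b IHb] n /=.
  (* Raising the upper bound by p creates the boundary terms; on the common range only the right
     factor depends on n. *)
  rewrite sumz_catr addrAC sumzB; congr (_ + _).
    apply: eq_sumz => i; rewrite WB_gen_diffS tensDr tensNr.
    by congr (tens _ (T _ _) - _); lia.
  by apply: eq_bigr => i _; congr (tens _ (T _ _)); lia.
(* Only the left factor of a boundary term depends on n, so the next difference turns [T b] into
   [T b.+1] there. *)
rewrite -/(conv_diff b.+1 c (n + p%:Z)) -/(conv_diff b.+1 c n) !IHb.
rewrite opprD addrACA -sumrB; congr (_ + _); apply: eq_bigr => i _.
by rewrite WB_gen_diffS tensDl tensNl; congr (tens (T _ _) _ - _); lia.
Qed.

(** The boundary terms split off by [conv_diffS] lie in degree (b + 1) + (c + 1), exactly the bound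
    needed; the convolution left at the end has one degree to spare. *)
Lemma filtWW_conv_diff b c n : FWW (b + c).+1 (conv_diff b c n).
Proof.
elim: b c n => [|b IHb] c n.
  apply: submodule_sumz => [|i]; first exact: submodule_filtWW.
  apply: (filtWW_tens (filtWB_gen_diff _ _) (filtWB_gen_diff _ _)); lia.
rewrite conv_diffS addSnnS.
apply: submoduleD => //; first exact: submodule_filtWW.
apply: submodule_sum => [|i]; first exact: submodule_filtWW.
apply: (filtWW_tens (filtWB_gen_diff _ _) (filtWB_gen_diff _ _)); lia.
Qed.

Lemma Delta_gen_diff b n :
  Delta (T b n) = inX (T b n) + inY (T b n) - conv_diff b 0 n.
Proof.
have [linD _ _ Dgen] := DeltaP.
elim: b n => [|b IHb] n /=.
  rewrite !WB_gen_diff0 Dgen; congr (_ - _); apply: eq_sumz => i.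
  by rewrite tens_WB_M mulr1 mul1r !WB_gen_diff0.
rewrite WB_gen_diffS addrC -scaleN1r linD !IHb scaleN1r /inX /inY.
rewrite scaleN1r addrC tensDl tensDr tensNl tensNr !opprD opprK.
by rewrite addrACA; congr (_ + _); rewrite addrACA; congr (_ + _); apply: addrC.
Qed.

Lemma filtWW_Delta_gen_diff b n : FWW b.+1 (Delta (T b n)).
Proof.
rewrite Delta_gen_diff; apply: submoduleB; first exact: submodule_filtWW.
  apply: submoduleD; first exact: submodule_filtWW.
    apply: (@filtWW_tens k N b.+1 0 _ _ _ (filtWB_gen_diff b n)) => //.
    by rewrite addn0.
  exact: (@filtWW_tens k N 0 b.+1 _ _ _ _ (filtWB_gen_diff b n)).
by have := filtWW_conv_diff b 0 n; rewrite addn0.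
Qed.


(** * Elements of [VB] whose multiples have a coproduct of controlled degree *)

Definition Delta_filtered (c : nat) (v : VB k) : Prop :=
  exists2 w : W, wbval w = v & FWW c (Delta w).
Local Notation Q := Delta_filtered.

Lemma submodule_Delta_filtered c : submodule (Q c).
Proof.
have [linD _ _ _] := DeltaP; have [F0 FL] := submodule_filtWW k N c.
have Delta0 : Delta 0 = 0.
  by have := linD (-1) 0 0; rewrite !scaleN1r oppr0 addr0 addNr.
split=> [|e _ _ [x <- Fx] [y <- Fy]]; first by exists 0; rewrite ?Delta0.
by exists (e *: x + y); rewrite ?linD //; apply: FL.
Qed.

Lemma Delta_filteredM c d v w : Q c v -> Q d w -> Q (c + d) (v * w).
Proof.
have [_ [_ mulD] _ _] := DeltaP.
move=> [x <- Fx] [y <- Fy]; exists (x * y) => //.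
by rewrite mulD; apply: filtWWM.
Qed.

Lemma Delta_filtered_anti c d v : (c <= d)%N -> Q d v -> Q c v.
Proof. by move=> le_cd [w <- Fw]; exists w => //; apply: filtWW_anti Fw. Qed.

Lemma Delta_filtered_X1V : Q 0 (bX k X1^-1%g).
Proof.
have [_ _ DX1V _] := DeltaP; exists (WB_X1V k) => //.
by rewrite DX1V tens_WB_M; apply: (@filtWW_tens k N 0 0).
Qed.

Lemma Delta_filtered_gen b n : Q b.+1 (t ^+ b * x0 n * u).
Proof. by exists (T b n) => //; apply: filtWW_Delta_gen_diff. Qed.

(* Left multiplication by X0 leaves WB, so membership is required after all
   the multiplications that bring the element back into WB. *)
Definition stably_filtered (c : nat) (v : VB k) : Prop :=
  forall b n, Q (c + b) (t ^+ b * x0 n * v).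
Local Notation P := stably_filtered.

Lemma submodule_stably_filtered c : submodule (P c).
Proof.
split=> [|e x y Px Py] b n; have [Q0 QL] := submodule_Delta_filtered (c + b).
  by rewrite mulr0.
by rewrite mulrDr -ga_scaleAr; apply: QL; [apply: Px | apply: Py].
Qed.

Lemma stably_filtered_anti c d v : (c <= d)%N -> P d v -> P c v.
Proof.
by move=> le_cd Pv b n; apply: Delta_filtered_anti (Pv b n); rewrite leq_add2r.
Qed.

Lemma stably_filteredW c v : P c v -> Q c v.
Proof. by move/(_ 0 0); rewrite addn0 expr0 [x0 0]bX_one !mul1r. Qed.

Lemma stably_filtered_x0 c n v : P c v -> P c (x0 n * v).
Proof.
move=> Pv b m; rewrite -mulrA [x0 m * _]mulrA -ga_baseM -gexpzD mulrA.
exact: Pv.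
Qed.

Lemma stably_filtered_t c v : P c v -> P c.+1 (t * v).
Proof.
move=> Pv b n; have t_x0 : x0 n * t = t * x0 n.
  rewrite mulrBr mulrBl mul1r mulr1 -!ga_baseM; congr (ga_base k _ - _).
  by rewrite -[(X0 ^+ p)%g]/(gexpz X0 p%:Z) -!gexpzD addrC.
rewrite mulrA -[_ * x0 n * t]mulrA t_x0 mulrA -exprSr addSnnS.
exact: Pv.
Qed.

(** The factor u completes t^b X0^n to [T b n], so t^b X0^n u v is a product of two elements of [WB]
    and Delta is multiplicative on it. *)
Lemma stably_filtered_u c v : P c v -> P c.+1 (u * v).
Proof.
move=> /stably_filteredW Qv b n; rewrite mulrA addSnnS addnC.
exact: Delta_filteredM (Delta_filtered_gen b n) Qv.
Qed.

(** Writing X1^-1 = 1 - u X1^-1 puts u next to X0^n: the first term is the hypothesis, the second a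
    product inside [WB]. *)
Lemma stably_filtered_X1V c v : P c v -> P c (bX k X1^-1%g * v).
Proof.
move=> Pv b n.
have -> : t ^+ b * x0 n * (bX k X1^-1%g * v) =
    t ^+ b * x0 n * v - t ^+ b * x0 n * u * (bX k X1^-1%g * v).
  rewrite -[_ * u * _]mulrA -mulrBr; congr (_ * _).
  by rewrite mulrA mulrBl -ga_baseM mulgV mul1r mulrBl mul1r opprB addrC subrK.
apply: submoduleB; [exact: submodule_Delta_filtered | exact: Pv |].
have := Delta_filteredM (Delta_filtered_gen b n)
  (Delta_filteredM Delta_filtered_X1V (stably_filteredW Pv)).
by apply: Delta_filtered_anti; lia.
Qed.

Lemma stably_filtered1 : P 1 u.
Proof. by move=> b n; rewrite add1n; apply: Delta_filtered_gen. Qed.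

(** One letter at a time: X0 and its inverse only shift n, and X1 = u + 1 where u even raises the
    degree. *)
Lemma stably_filtered_base c x v : P c v -> P c (bX k x * v).
Proof.
move=> Pv; elim/freegroup_ind: x => [|[] x Px|[] x Px].
- by rewrite bX_one mul1r.
- rewrite /bX ga_baseM -mulrA -[ga_base k _](subrK 1) mulrDl mul1r.
  apply: (submoduleD (submodule_stably_filtered c) _ Px).
  exact: (stably_filtered_anti (leqnSn c) (stably_filtered_u Px)).
- by rewrite /bX ga_baseM -mulrA; apply: (stably_filtered_x0 1).
- by rewrite /bX ga_baseM -mulrA; apply: stably_filtered_X1V.
by rewrite /bX ga_baseM -mulrA; apply: (stably_filtered_x0 (- 1)).
Qed.

(** * Multiplication by I raises the degree by one *)

Definition raising (f : VB k) : Prop := forall c v, P c v -> P c.+1 (f * v).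

Lemma submodule_raising : submodule raising.
Proof.
split=> [|e f g rf rg] c v Pv; have [P0 PL] := submodule_stably_filtered c.+1.
  by rewrite mul0r.
by rewrite mulrDl -ga_scaleAl; apply: PL; [apply: rf | apply: rg].
Qed.

Lemma raising_baseM x f : raising f -> raising (bX k x * f).
Proof. by move=> rf c v Pv; rewrite -mulrA; apply/stably_filtered_base/rf. Qed.

(** The relation [raising (bX k x - bX k y)] is an equivalence on F_2 invariant under left
    multiplication. The aim is that it contains equality of images in mu_N. *)
Lemma raising_trans x y z :
  raising (bX k x - bX k y) -> raising (bX k y - bX k z) ->
  raising (bX k x - bX k z).
Proof.
move=> rxy ryz; rewrite -(subrKA (bX k y)).
exact: submoduleD submodule_raising rxy ryz.
Qed.

Lemma raising_mull x y z :
  raising (bX k x - bX k y) -> raising (bX k (z * x)%g - bX k (z * y)%g).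
Proof. by rewrite /bX !ga_baseM -mulrBr; apply: raising_baseM. Qed.

Lemma raising_opp x y :
  raising (bX k x - bX k y) -> raising (bX k y - bX k x).
Proof.
move=> rxy; rewrite -opprB -scaleN1r.
exact: submoduleZ submodule_raising rxy.
Qed.

(** The difference is u x, and x preserves each M_c. *)
Lemma raising_X1 x : raising (bX k (X1 * x)%g - bX k x).
Proof.
move=> c v Pv; rewrite /bX ga_baseM -[X in _ - X]mul1r -mulrBl -mulrA.
exact/stably_filtered_u/stably_filtered_base.
Qed.

Lemma raising_X0 : raising (bX k (X0 ^+ p)%g - bX k 1%g).
Proof. by rewrite bX_one => c v; apply: stably_filtered_t. Qed.

(** By induction on the letters: X1 and its inverse keep the class, while X0 and its inverse move i
    cyclically modulo p. *)
Lemma raising_X0_pow x : exists2 i : 'I_p,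
  F2_to_mu N x = (zeta N ^+ i)%g & raising (bX k x - bX k (X0 ^+ i)%g).
Proof.
have p_gt0 := prim_order_gt0 zeta_prim.
elim/freegroup_ind: x => [|[] x [i xi rx]|[] x [i xi rx]].
- exists (Ordinal p_gt0); rewrite ?F2_to_mu1 // subrr.
  by case: submodule_raising.
- exists i; first by rewrite F2_to_muM F2_to_mu_X1 mul1g.
  exact: raising_trans (raising_X1 x) rx.
- have := raising_mull X0 rx; rewrite -expgS => rX.
  have phi_X : F2_to_mu N (X0 * x)%g = (zeta N ^+ i.+1)%g.
    by rewrite F2_to_muM F2_to_mu_X0 xi expgS.
  have := ltn_ord i; rewrite leq_eqVlt => /orP[/eqP ip|ip]; last first.
    by exists (Ordinal ip).
  (* Here i = p - 1, and the exponent wraps around to 0 because X0^p is related to 1. *)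
  exists (Ordinal p_gt0); first by rewrite phi_X ip zeta_p.
  by apply: raising_trans rX _; rewrite ip; apply: raising_X0.
(* The relation for X1 is used at X1^-1 x and read backwards. *)
- have X1x : x = (X1 * (X1^-1 * x))%g by rewrite mulVKg.
  exists i; first by rewrite -xi {2}X1x [RHS]F2_to_muM F2_to_mu_X1 mul1g.
  by apply: raising_trans rx; rewrite {2}X1x; apply/raising_opp/raising_X1.
have := raising_mull X0^-1%g rx.
have phi_X : (zeta N * F2_to_mu N (X0^-1 * x) = zeta N ^+ i)%g.
  by rewrite -F2_to_mu_X0 -F2_to_muM mulVKg F2_to_mu_X0.
case: i xi rx phi_X => -[|i] ip /= xi rx phi_X rX.
  (* Exponent 0 wraps around to p - 1. *)
  have ip' : (p.-1 < p)%N by rewrite prednK.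
  exists (Ordinal ip') => /=.
    by apply: (mulgI (zeta N)); rewrite phi_X -expgS prednK // zeta_p.
  apply: raising_trans rX _; apply: raising_opp.
  have -> : (X0 ^+ p.-1 = X0^-1 * X0 ^+ p)%g.
    by rewrite -[in RHS](prednK p_gt0) expgS mulKg.
  by apply: raising_mull; apply: raising_X0.
exists (Ordinal (ltnW ip)) => /=.
  by apply: (mulgI (zeta N)); rewrite phi_X expgS.
by move: rX; rewrite expgS mulKg.
Qed.

(** Replacing each x by a representative depending only on its image sends f to 0, so f is a
    combination of differences between x and its representative. *)
Lemma raising_augN f : @augN k N f -> raising f.
Proof.
(* The default 1 is never taken at the image of an element of F_2, by [raising_X0_pow]. *)
pose s z : F2 := if [pick i : 'I_p | zeta N ^+ i == z]%g is Some i
                 then (X0 ^+ i)%g else 1%g.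
have raise_s x : raising (bX k x - bX k (s (F2_to_mu N x))).
  have [i xi rx] := raising_X0_pow x; rewrite /s.
  case: pickP => [j /eqP|/(_ i)]; last by rewrite xi eqxx.
  by rewrite xi => /zeta_inj ->.
move=> If; have -> : f = ga_lin (fun x => bX k x - bX k (s (F2_to_mu N x))) f.
  have s0 : ga_lin (fun x => bX k (s (F2_to_mu N x))) f = 0.
    exact: (augN_lin (fun z => bX k (s z)) If).
  rewrite -[LHS]ga_lin_id -[LHS]subr0 -[X in _ - X]s0 /ga_lin -sumrB.
  by apply: eq_bigr => x _; rewrite scalerBr.
exact: ga_lin_in submodule_raising raise_s.
Qed.

Lemma stably_filtered_mulu n v : filtVB N n%:Z v -> P n.+1 (v * u).
Proof.
elim: n v => [|n IHn] v.
  move=> _; elim/ga_base_ind: v => [|x]; last first.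
    exact: stably_filtered_base stably_filtered1.
  exact: submodule_mulr (submodule_stably_filtered 1).
apply: (filtVBSl (P := [set v | P n.+2 (v * u)])) => [|f g If Fg] /=.
  exact: submodule_mulr (submodule_stably_filtered n.+2).
by rewrite -mulrA; apply: raising_augN => //; apply: IHn.
Qed.

Lemma filtWW_Delta n w : FW n.+1 w -> FWW n.+1 (Delta w).
Proof.
move=> /filtWB_mulu[v wv Fv].
have [w' w'v Fw'] := stably_filteredW (stably_filtered_mulu Fv).
by have -> : w = w' by apply: val_inj; rewrite /= wv w'v.
Qed.

End Coproduct.

Theorem theorem1p3 (k : comPzRingType) (iota : {rmorphism rat -> k})
    (N : nat) (N_ge1 : (1 <= N)%N)
    (Delta : WB k -> tensor (WB k) (WB k)) (DeltaP : is_DeltaWB Delta)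
    (m : int) :
  Delta @` filtWB N m `<=` filtWWB N m.
Proof.
move=> _ [w Fw <-]; case: m Fw => [[|n]|n] Fw; try exact: filtWWB_le0.
(* The order p comes from zeta^N = 1 alone, which avoids proving that it equals N. *)
have [p zeta_prim _] := prim_order_exists N_ge1 (muval_exp (zeta N)).
exact/filtWW_sub/(filtWW_Delta zeta_prim DeltaP).
Qed.
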